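(* Let $P$ be an LCM monoid and let $P^{\mathrm{op}}$ be its opposite monoid. Then $C^*_{\mathrm{ts}}(P)\cong C^*_{\mathrm{ts}}(P^{\mathrm{op}})$.
   Context: An LCM monoid is a cancellative (left and right) monoid $P$ such that for all $p,q\in P$: $pP\cap qP$ is either empty or equal to $rP$ for some $r\in P$, and $Pp\cap Pq$ is either empty or equal to $Pr$ for some $r\in P$. $P^{\mathrm{op}}$ has the same elements as $P$ with multiplication $p\cdot q=qp$; it is LCM iff $P$ is. For a cancellative monoid $P$, let $\Delta=\{(bx,x): b,x\in P\}\subseteq P\times P$. For $Y\subseteq\Delta$ and $p\in P$ put $Y_p=\{(bpx,px): b,x\in P,\ (bpx,x)\in Y\}$ and $Y^p=\{(bpx,x): b,x\in P,\ (bpx,px)\in Y\}$. Let $\mathcal{J}(P)$ be the smallest collection of subsets of $\Delta$ which contains $\Delta$ and $\emptyset$, is closed under finite intersections, and contains $Y_p$ and $Y^p$ whenever $Y\in\mathcal{J}(P)$ and $p\in P$. $C^*_{\mathrm{ts}}(P)$ is the universal unital C*-algebra generated by partial isometries $\{S_p: p\in P\}$ and projections $\{f_Y: Y\in\mathcal{J}(P)\}$ such that (i) $S_pS_q=S_{pq}$; (ii) $f_Yf_Z=f_{Y\cap Z}$; (iii) $f_\Delta=1$, $f_\emptyset=0$; (iv) $S_pf_YS_p^*=f_{Y_p}$; (v) $S_p^*f_YS_p=f_{Y^p}$, for all $p,q\in P$ and $Y,Z\in\mathcal{J}(P)$. *)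

(* Defs.v *)
From HB Require Import structures.
From mathcomp Require Import all_boot all_order all_algebra.
From mathcomp Require Import all_classical all_reals all_analysis.
From mathcomp Require Import complex.

Set Implicit Arguments.
Unset Strict Implicit.
Unset Printing Implicit Defensive.

Import Order.TTheory GRing.Theory Num.Theory.
Import numFieldNormedType.Exports.

Local Open Scope classical_set_scope.
Local Open Scope ring_scope.

(* Unital complex C*-algebras: a Banach space over R[i] with a unital associative
   bilinear product, a submultiplicative norm, and an involution satisfying the
   C*-identity.  The product is part of this interface because the library has
   no structure joining its rings with its normed modules.  The norm of a normed
   module over R[i] takes its values in R[i], where z <= w means that w - z is a
   nonnegative real, and k^* is the complex conjugate of the scalar k.  The zero
   algebra is allowed. *)
HB.mixin Record isCStarAlgebra (R : realType) A
    of CompleteNormedModule R[i] A := {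
  cmul : A -> A -> A;
  cone : A;
  cstar : A -> A;
  cmulA : associative cmul;
  cmul1x : left_id cone cmul;
  cmulx1 : right_id cone cmul;
  cmulDl : forall x y z : A, cmul (x + y) z = cmul x z + cmul y z;
  cmulDr : forall x y z : A, cmul x (y + z) = cmul x y + cmul x z;
  cmulZl : forall (k : R[i]) (x y : A), cmul (k *: x) y = k *: cmul x y;
  cmulZr : forall (k : R[i]) (x y : A), cmul x (k *: y) = k *: cmul x y;
  cstarD : forall x y : A, cstar (x + y) = cstar x + cstar y;
  cstarZ : forall (k : R[i]) (x : A), cstar (k *: x) = k^* *: cstar x;
  cstarM : forall x y : A, cstar (cmul x y) = cmul (cstar y) (cstar x);
  cstarK : involutive cstar;
  cnormM : forall x y : A, `|cmul x y| <= `|x| * `|y|;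
  cnorm_star : forall x : A, `|cmul (cstar x) x| = `|x| ^+ 2
}.

#[short(type="cstarAlgType")]
HB.structure Definition CStarAlgebra (R : realType) :=
  {A of CompleteNormedModule R[i] A & isCStarAlgebra R A}.

Arguments cone {R s}.

Reserved Notation "x ** y" (at level 40, left associativity).
Notation "x ** y" := (cmul x y) : ring_scope.

Section CStar.
Variable R : realType.

Record star_hom (A B : cstarAlgType R) (phi : A -> B) : Prop := StarHom {
  star_homD : forall x y : A, phi (x + y) = phi x + phi y;
  star_homZ : forall (k : R[i]) (x : A), phi (k *: x) = k *: phi x;
  star_homM : forall x y : A, phi (x ** y) = phi x ** phi y;
  star_hom1 : phi cone = cone;
  star_homV : forall x : A, phi (cstar x) = cstar (phi x)
}.

(* Bijective *-homomorphisms between C*-algebras are isometric. *)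
Definition cstar_isomorphic (A B : cstarAlgType R) : Prop :=
  exists phi : A -> B, star_hom phi /\ bijective phi.

Definition partial_isometry (A : cstarAlgType R) (s : A) : Prop :=
  s ** cstar s ** s = s.

Definition cstar_projection (A : cstarAlgType R) (e : A) : Prop :=
  e ** e = e /\ cstar e = e.

End CStar.

Section OppositeMonoid.
Variable P : monoidType.

Definition op_monoid : Type := P.

HB.instance Definition _ := Choice.on op_monoid.

Definition op_mul (p q : op_monoid) : op_monoid := ((q : P) * (p : P))%g.
Definition op_one : op_monoid := (1 : P)%g.

Lemma op_mulA : associative op_mul.
Proof. by move=> p q r; rewrite /op_mul mulgA. Qed.

Lemma op_mul1 : left_id op_one op_mul.
Proof. by move=> p; rewrite /op_mul mulg1. Qed.

Lemma op_1mul : right_id op_one op_mul.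
Proof. by move=> p; rewrite /op_mul mul1g. Qed.

HB.instance Definition _ :=
  isMonoid.Build op_monoid op_mulA op_mul1 op_1mul.

End OppositeMonoid.

Section LCM.
Variable P : monoidType.

Definition cancellative : Prop :=
  right_injective (fun p q : P => (p * q)%g) /\
  left_injective (fun p q : P => (p * q)%g).

Definition right_ideal (p : P) : set P := [set (p * x)%g | x in setT].
Definition left_ideal (p : P) : set P := [set (x * p)%g | x in setT].

Definition LCM_monoid : Prop :=
  [/\ cancellative,
      forall p q : P, right_ideal p `&` right_ideal q = set0 \/
        exists r : P, right_ideal p `&` right_ideal q = right_ideal r
    & forall p q : P, left_ideal p `&` left_ideal q = set0 \/
        exists r : P, left_ideal p `&` left_ideal q = left_ideal r].

End LCM.

Section ConstructibleSets.
Variable P : monoidType.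

Definition Delta : set (P * P) :=
  [set z | exists b x : P, z = ((b * x)%g, x)].

(* The set Y_p. *)
Definition set_sub (Y : set (P * P)) (p : P) : set (P * P) :=
  [set z | exists b x : P,
     Y ((b * p * x)%g, x) /\ z = ((b * p * x)%g, (p * x)%g)].

(* The set Y^p. *)
Definition set_sup (Y : set (P * P)) (p : P) : set (P * P) :=
  [set z | exists b x : P,
     Y ((b * p * x)%g, (p * x)%g) /\ z = ((b * p * x)%g, x)].

(* The collection J(P); the empty intersection is Delta. *)
Inductive constructible : set (P * P) -> Prop :=
| constructible_Delta : constructible Delta
| constructible_set0 : constructible set0
| constructible_setI Y Z :
    constructible Y -> constructible Z -> constructible (Y `&` Z)
| constructible_sub Y p : constructible Y -> constructible (set_sub Y p)
| constructible_sup Y p : constructible Y -> constructible (set_sup Y p).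

End ConstructibleSets.

Arguments Delta P : clear implicits.

Section UniversalAlgebra.
Variables (R : realType) (P : monoidType).

(* The projections f_Y are indexed by J(P): f is a total function on sets, but
   only its values on constructible sets are constrained or used. *)
Record ts_family (A : cstarAlgType R) (S : P -> A) (f : set (P * P) -> A)
    : Prop := TsFamily {
  ts_isometry : forall p : P, partial_isometry (S p);
  ts_projection : forall Y, constructible Y -> cstar_projection (f Y);
  ts_mul : forall p q : P, S p ** S q = S (p * q)%g;
  ts_setI : forall Y Z, constructible Y -> constructible Z ->
    f Y ** f Z = f (Y `&` Z);
  ts_Delta : f (Delta P) = cone;
  ts_set0 : f set0 = 0;
  ts_sub : forall (p : P) Y, constructible Y ->
    S p ** f Y ** cstar (S p) = f (set_sub Y p);
  ts_sup : forall (p : P) Y, constructible Y ->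
    cstar (S p) ** f Y ** S p = f (set_sup Y p)
}.

Definition ts_compatible (A B : cstarAlgType R) (S : P -> A)
    (f : set (P * P) -> A) (T : P -> B) (g : set (P * P) -> B)
    (phi : A -> B) : Prop :=
  [/\ star_hom phi,
      forall p : P, phi (S p) = T p
    & forall Y, constructible Y -> phi (f Y) = g Y].

(* The universal property defining C*_ts(P).  Uniqueness of the induced map
   expresses that A is generated by the S p and the f Y. *)
Definition is_Cts (A : cstarAlgType R) (S : P -> A)
    (f : set (P * P) -> A) : Prop :=
  ts_family S f /\
  forall (B : cstarAlgType R) (T : P -> B) (g : set (P * P) -> B),
    ts_family T g -> exists! phi : A -> B, ts_compatible S f T g phi.

End UniversalAlgebra.

(* Main.v *)
Require Import Defs.
From mathcomp Require Import all_boot all_order all_algebra.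
From mathcomp Require Import all_classical all_reals all_analysis.
From mathcomp Require Import complex.

(* By cancellation, a point (bx, x) of Delta is the same as the pair (b, x), and
   S_p acts on such pairs by (bp, x) |-> (b, px).  Exchanging the two coordinates
   identifies Delta(P) with Delta(P^op) and turns the action of p into the
   inverse of the action of p for P^op, so it exchanges Y_p and Y^p.  Hence
   S_p |-> T_p^*, f_Y |-> g_(flip Y) satisfies the defining relations, and so does
   the assignment in the other direction. *)

Local Open Scope classical_set_scope.
Local Open Scope ring_scope.

Section Flip.
Context {P Q : monoidType} (h : P -> Q).

Definition antimultiplicative := forall p q : P, h (p * q)%g = (h q * h p)%g.

(** When [h] reverses products, [h (b * x) = h x * h b], so the image of the point with pair
    [(b, x)] has pair [(h x, h b)]. *)
Definition flip (Y : set (P * P)) : set (Q * Q) :=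
  [set z | exists b x : P, Y ((b * x)%g, x) /\ z = (h (b * x)%g, h b)].

Hypothesis hM : antimultiplicative.
Hypothesis h_bij : bijective h.
Hypothesis cP : cancellative P.

(** Injectivity of [h] recovers [b] and [b * x], and left cancellation then recovers [x]. *)
Lemma flipE Y (b x : P) : flip Y (h (b * x)%g, h b) <-> Y ((b * x)%g, x).
Proof.
split=> [[c [w [Yw [/(bij_inj h_bij) e /(bij_inj h_bij) ebc]]]]|Yx].
  by rewrite -ebc in Yw e; rewrite (cP.1 b _ _ e).
by exists b, x.
Qed.

Lemma flip_Delta : flip (Delta P) = Delta Q.
Proof.
have [k hK kK] := h_bij.
apply/seteqP; split=> z /=.
  by move=> [b [x [_ ->]]]; exists (h x), (h b); rewrite hM.
move=> [b [x ->]]; exists (k x), (k b); split; first by exists (k x), (k b).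
by rewrite hM !kK.
Qed.

Lemma flip_set0 : flip set0 = set0.
Proof. by apply/seteqP; split=> z // [b [x []]]. Qed.

Lemma flip_setI Y Z : flip (Y `&` Z) = flip Y `&` flip Z.
Proof.
apply/seteqP; split=> z.
  by move=> [b [x [[Yx Zx] ->]]]; split; exists b, x.
by move=> [[b [x [Yx ->]]] /flipE Zx]; exists b, x.
Qed.

(** On pairs, $Y_p$ takes [(b * p, x)] to [(b, p * x)], while $Y^p$ takes [(b, p * x)] to
    [(b * p, x)]. Swapping coordinates and reversing products turns each rule into the other. *)
Lemma flip_sub Y p : flip (set_sub Y p) = set_sup (flip Y) (h p).
Proof.
have [k hK kK] := h_bij.
apply/seteqP; split=> z /=.
  move=> [c [w [[b [x [Yx [e ew]]]] ->]]].
  have ec : c = b by apply: (cP.2 w); rewrite e ew mulgA.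
  exists (h x), (h b); rewrite ec ew -!hM !mulgA; split=> //.
  by apply/flipE.
(* Elements of [Q] are written as values of [h], so that products in [Q] become values of [h] and
   [flipE] applies. *)
move=> [b [x []]]; rewrite -(kK b) -(kK x) -!hM !mulgA => /flipE Yx ->.
by exists (k x), (p * k b)%g; split; [exists (k x), (k b)|]; rewrite ?mulgA.
Qed.

Lemma flip_sup Y p : flip (set_sup Y p) = set_sub (flip Y) (h p).
Proof.
have [k hK kK] := h_bij.
apply/seteqP; split=> z /=.
  move=> [c [w [[b [x [Yx [e ew]]]] ->]]].
  have ec : c = (b * p)%g by apply: (cP.2 w); rewrite e ew.
  exists (h x), (h b); rewrite ec ew -!hM !mulgA; split=> //.
  (* The point [(b * p * x, p * x)] has pair [(b, p * x)], so its product is regrouped for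
     [flipE]. *)
  by rewrite -mulgA; apply/flipE; rewrite mulgA.
move=> [b [x []]]; rewrite -(kK b) -(kK x) -!hM !mulgA.
rewrite -mulgA => /flipE Yx ->.
by exists (k x * p)%g, (k b); split; [exists (k x), (k b)|]; rewrite ?mulgA // -mulgA.
Qed.

Lemma constructible_flip Y : constructible Y -> constructible (flip Y).
Proof.
elim=> [||Y1 Z _ IY _ IZ|Y1 p _ IY|Y1 p _ IY].
- by rewrite flip_Delta; constructor.
- by rewrite flip_set0; constructor.
- by rewrite flip_setI; constructor.
- by rewrite flip_sub; constructor.
- by rewrite flip_sup; constructor.
Qed.

(** The star reverses products and so does [h], hence the new family is multiplicative. Replacing
    [T] by its adjoint interchanges the two conjugation relations, which matches the exchange made
    by [flip]. *)
Lemma ts_family_flip (R : realType) (B : cstarAlgType R) (T : Q -> B)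
    (g : set (Q * Q) -> B) :
  ts_family T g -> ts_family (fun p => cstar (T (h p))) (fun Y => g (flip Y)).
Proof.
case=> Tiso gproj TM gI gD g0 gsub gsup; split.
- by move=> p; rewrite /partial_isometry -!cstarM cmulA Tiso.
- by move=> Y cY; apply: gproj; apply: constructible_flip.
- by move=> p q; rewrite -cstarM TM hM.
- by move=> Y Z cY cZ; rewrite gI ?flip_setI //; apply: constructible_flip.
- by rewrite flip_Delta.
- by rewrite flip_set0.
- move=> p Y cY; rewrite cstarK flip_sub gsup //; exact: constructible_flip.
- move=> p Y cY; rewrite cstarK flip_sup gsub //; exact: constructible_flip.
Qed.

End Flip.

Lemma constructible_subset_Delta {P : monoidType} (Y : set (P * P)) :
  constructible Y -> Y `<=` Delta P.
Proof.
elim=> [//|//|Y1 Z _ IY _ _ z [/IY]//|Y1 p _ _|Y1 p _ _] z /= [b [x [_ ->]]].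
  by exists b, (p * x)%g; rewrite mulgA.
by exists (b * p)%g, x.
Qed.

(** The pair [(b, x)] goes to [(h x, h b)] and back. Points outside [Delta P] are lost by [flip],
    hence the inclusion hypothesis. *)
Lemma flipK {P Q : monoidType} (h : P -> Q) (k : Q -> P) (Y : set (P * P)) :
  cancel h k -> cancel k h -> antimultiplicative h -> cancellative Q ->
  Y `<=` Delta P -> flip k (flip h Y) = Y.
Proof.
move=> hK kK hM cQ YD; apply/seteqP; split=> z /=.
  move=> [c [w [[b [x [Yx [e ew]]]] ->]]].
  have -> : c = h x by apply: (cQ.2 w); rewrite e ew hM.
  by rewrite ew -hM !hK.
move=> Yz; have [b [x ez]] := YD _ Yz; rewrite ez in Yz *.
exists (h x), (h b); rewrite -hM !hK; split=> //.
by exists b, x.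
Qed.

Section StarHom.
Context {R : realType}.

Lemma star_hom_id (A : cstarAlgType R) : star_hom (@id A).
Proof. by []. Qed.

Lemma star_hom_comp (A B C : cstarAlgType R) (phi : A -> B) (psi : B -> C) :
  star_hom phi -> star_hom psi -> star_hom (psi \o phi).
Proof.
move=> [D1 Z1 M1 U1 V1] [D2 Z2 M2 U2 V2]; split=> /=.
- by move=> x y; rewrite D1 D2.
- by move=> k x; rewrite Z1 Z2.
- by move=> x y; rewrite M1 M2.
- by rewrite U1 U2.
- by move=> x; rewrite V1 V2.
Qed.

(** Both [phi] and the identity are induced by the family [S], [f] itself, so uniqueness makes them
    equal. *)
Lemma is_Cts_endo_id (P : monoidType) (A : cstarAlgType R) (S : P -> A)
    (f : set (P * P) -> A) (phi : A -> A) :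
  is_Cts S f -> ts_compatible S f S f phi -> phi = id.
Proof.
move=> [fam univ] phiC; have [chi [_ uniq_chi]] := univ _ _ _ fam.
rewrite -(uniq_chi _ phiC); apply: uniq_chi.
by split=> //; exact: star_hom_id.
Qed.

(** On generators the two stars cancel, and so do the two flips. *)
Lemma ts_compatible_flip_id (P Q : monoidType) (h : P -> Q) (k : Q -> P)
    (A B : cstarAlgType R) (S : P -> A) (f : set (P * P) -> A)
    (T : Q -> B) (g : set (Q * Q) -> B) (phi : A -> B) (psi : B -> A) :
  cancel h k -> cancel k h -> antimultiplicative h ->
  cancellative P -> cancellative Q ->
  ts_compatible S f (fun p => cstar (T (h p))) (fun Y => g (flip h Y)) phi ->
  ts_compatible T g (fun q => cstar (S (k q))) (fun Y => f (flip k Y)) psi ->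
  ts_compatible S f S f (psi \o phi).
Proof.
move=> hK kK hM cP cQ [phiH phiS phif] [psiH psiT psig]; split.
- exact: star_hom_comp.
- by move=> p /=; rewrite phiS (star_homV psiH) psiT cstarK hK.
- move=> Y cY /=; rewrite phif // psig; last first.
    by apply: constructible_flip => //; exists k.
  by rewrite (flipK h k) //; exact: constructible_subset_Delta.
Qed.

Lemma is_Cts_anti_isomorphic (P Q : monoidType) (h : P -> Q) (k : Q -> P)
    (A B : cstarAlgType R) (S : P -> A) (f : set (P * P) -> A)
    (T : Q -> B) (g : set (Q * Q) -> B) :
  cancel h k -> cancel k h -> antimultiplicative h ->
  cancellative P -> cancellative Q ->
  is_Cts S f -> is_Cts T g -> cstar_isomorphic A B.
Proof.
move=> hK kK hM cP cQ hA hB.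
have kM : antimultiplicative k.
  by move=> p q; apply: (can_inj hK); rewrite hM !kK.
have h_bij : bijective h by exists k.
have k_bij : bijective k by exists h.
have [phi [phiC _]] := hA.2 _ _ _ (ts_family_flip h hM h_bij cP _ _ _ _ hB.1).
have [psi [psiC _]] := hB.2 _ _ _ (ts_family_flip k kM k_bij cQ _ _ _ _ hA.1).
have psiphi : psi \o phi = id.
  apply: (is_Cts_endo_id _ _ _ _ _ hA).
  exact: (ts_compatible_flip_id _ _ h k _ _ _ _ _ _ _ _ hK kK hM cP cQ phiC psiC).
have phipsi : phi \o psi = id.
  apply: (is_Cts_endo_id _ _ _ _ _ hB).
  exact: (ts_compatible_flip_id _ _ k h _ _ _ _ _ _ _ _ kK hK kM cQ cP psiC phiC).
exists phi; split; first by case: phiC.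
by exists psi => x; [apply: (congr1 (@^~ x) psiphi)|apply: (congr1 (@^~ x) phipsi)].
Qed.

End StarHom.

Lemma cancellative_op (P : monoidType) :
  cancellative P -> cancellative (op_monoid P).
Proof. by move=> [cl cr]; split=> p q r; [exact: cr|exact: cl]. Qed.

Theorem proposition2p26 (R : realType) (P : monoidType) (hP : LCM_monoid P)
    (A : cstarAlgType R) (S : P -> A) (f : set (P * P) -> A)
    (hA : is_Cts S f)
    (B : cstarAlgType R) (T : op_monoid P -> B)
    (g : set (op_monoid P * op_monoid P) -> B)
    (hB : is_Cts T g) :
  cstar_isomorphic A B.
Proof.
have [cP _ _] := hP.
(* Both maps are the identity on elements; [h] reverses products by the definition of [op_mul]. *)
pose h (p : P) : op_monoid P := p.
pose k (p : op_monoid P) : P := p.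
by apply: (is_Cts_anti_isomorphic _ _ h k _ _ _ _ _ _ _ _ _ cP
  (cancellative_op _ cP) hA hB).
Qed.
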